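(* For all integers $1 \leq k \leq n$, \[ \sum_{\substack{\alpha \vDash n\\ \ell(\alpha) = k}} g^{\alpha} = \left\{ \begin{matrix} n \\ k \end{matrix} \right\}, \] where the sum is over all compositions $\alpha$ of $n$ with exactly $k$ parts and $\left\{ \begin{smallmatrix} n \\ k \end{smallmatrix} \right\}$ is the Stirling number of the second kind (the number of partitions of the set $\{1,\dots,n\}$ into $k$ nonempty blocks).
   Context: A composition $\alpha=(\alpha_1,\dots,\alpha_{\ell(\alpha)})$ of $n$ (written $\alpha \vDash n$) is a finite tuple of positive integers summing to $n$; $\ell(\alpha)$ is its number of parts. The diagram of $\alpha$ consists of left-justified rows of cells, row $i$ having $\alpha_i$ cells (rows indexed from the bottom, first row at the bottom). A standard immaculate tableau of shape $\alpha\vDash n$ is a filling of the diagram of $\alpha$ with the labels $1,2,\dots,n$, each used exactly once, such that the entries of the first column strictly increase from row $1$ to row $\ell(\alpha)$ and each row is increasing from left to right. $g^{\alpha}$ denotes the number of standard immaculate tableaux of shape $\alpha$. *)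

(* Defs.v *)
From mathcomp Require Import all_boot.
Set Implicit Arguments.
Unset Strict Implicit.
Unset Printing Implicit Defensive.

Definition is_composition (n : nat) (alpha : seq nat) : bool :=
  all (fun a => 0 < a) alpha && (sumn alpha == n).

(* Rows and columns are numbered from 0, row 0 being the bottom row; the cell
   in row i and column j is [Tagged _ j] with [j : 'I_(nth 0 alpha i)]. *)
Definition cell (alpha : seq nat) : finType :=
  {i : 'I_(size alpha) & 'I_(nth 0 alpha i)}.

Definition cell_row (alpha : seq nat) (c : cell alpha) : nat := tag c.

Definition cell_col (alpha : seq nat) (c : cell alpha) : nat := tagged c.

(* The ordinal v : 'I_(sumn alpha) stands for the label v + 1. *)
Definition filling (alpha : seq nat) : finType :=
  {ffun cell alpha -> 'I_(sumn alpha)}.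

Definition standard_immaculate (alpha : seq nat) (T : filling alpha) : bool :=
  [&& [forall v : 'I_(sumn alpha), #|[set c : cell alpha | T c == v]| == 1],
      [forall c : cell alpha, forall d : cell alpha,
        [&& cell_col c == 0, cell_col d == 0 & cell_row c < cell_row d]
          ==> (T c < T d)]
    & [forall c : cell alpha, forall d : cell alpha,
        (cell_row c == cell_row d) && (cell_col c < cell_col d)
          ==> (T c < T d)]].

Definition num_immaculate (alpha : seq nat) : nat :=
  #|[set T : filling alpha | standard_immaculate T]|.

(* Every part of a composition of n is at most n, so the tuples over 'I_n.+1
   account for all compositions of n with k parts. *)
Definition compositions (n k : nat) : {set k.-tuple 'I_n.+1} :=
  [set a : k.-tuple 'I_n.+1 | is_composition n (map (@nat_of_ord n.+1) a)].

Definition stirling2 (n k : nat) : nat :=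
  #|[set P : {set {set 'I_n}} | partition P [set: 'I_n] & #|P| == k]|.

(* Main.v *)
(** Recording for every label the row that contains it turns a standard
    immaculate tableau with [k] rows into a word [f : [n] -> [k]]. The rows
    being increasing, the tableau is recovered from [f]: the label [v] sits in
    column #{u < v | f u = f v}. The words obtained from the tableaux of shape
    [alpha] are those with content [alpha] whose fibers are nonempty and sorted
    by their minima, so summing over [alpha] counts all words with nonempty
    fibers sorted by minima. Such a word is the same thing as the set partition
    formed by its fibers, since the blocks of a partition can be sorted by
    their minima in exactly one way. *)

Require Import Defs.
From mathcomp Require Import all_boot.

Set Implicit Arguments.
Unset Strict Implicit.
Unset Printing Implicit Defensive.

(** * Counting through a relation *)

(** Double counting of the related pairs: each [x] lies in at least one, each [y] in at most one.
    With a relation, no map from [A] to [B] has to be written down. *)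
Lemma leq_card_rel (X Y : finType) (A : {set X}) (B : {set Y})
    (R : X -> Y -> bool) :
  {in A, forall x, exists2 y, y \in B & R x y} ->
  {in A &, forall x1 x2, {in B, forall y, R x1 y -> R x2 y -> x1 = x2}} ->
  #|A| <= #|B|.
Proof.
move=> totR injR.
have le1 : #|A| <= \sum_(x in A) \sum_(y in B | R x y) 1.
  rewrite -sum1_card; apply: leq_sum => x /totR[y yB Rxy].
  by rewrite (bigD1 y) ?yB.
apply: leq_trans le1 _; rewrite (exchange_big_dep (mem B)) /=; last first.
  by move=> x y _ /andP[].
rewrite -sum1_card; apply: leq_sum => y yB.
have -> : \sum_(x in A | (y \in B) && R x y) 1 = #|[set x in A | R x y]|.
  by rewrite -sum1_card; apply: eq_bigl => x; rewrite inE yB.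
apply/card_le1_eqP => x1 x2; rewrite !inE => /andP[x1A Rx1] /andP[x2A Rx2].
exact: (injR _ _ x2A x1A y yB Rx2 Rx1).
Qed.

(** * Positions in a finite strict total order *)

Section Rank.

Variables (X : finType) (P : {set X}) (lt : rel X).
Hypothesis lt_irr : irreflexive lt.
Hypothesis lt_trans : transitive lt.
Hypothesis lt_total : {in P &, forall x y, x != y -> lt x y || lt y x}.

Definition rank_in (x : X) := #|[set y in P | lt y x]|.

Lemma rank_in_lt x : x \in P -> rank_in x < #|P|.
Proof.
move=> xP; apply: proper_card; apply/properP; split.
  by apply/subsetP => y; rewrite inE => /andP[].
by exists x => //; rewrite inE lt_irr andbF.
Qed.

Lemma rank_in_mono x y : x \in P -> lt x y -> rank_in x < rank_in y.
Proof.
move=> xP xy; apply: proper_card; apply/properP; split.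
  by apply/subsetP => z; rewrite !inE => /andP[-> zx]; apply: lt_trans zx xy.
by exists x; rewrite inE ?xP ?lt_irr.
Qed.

Lemma ltn_rank_in x y : x \in P -> y \in P ->
  (rank_in x < rank_in y) = lt x y.
Proof.
move=> xP yP; apply/idP/idP => [rxy|]; last exact: rank_in_mono.
have [xy|/(lt_total xP yP)/orP[//|yx]] := eqVneq x y.
  by rewrite xy ltnn in rxy.
by have := ltn_trans rxy (rank_in_mono yP yx); rewrite ltnn.
Qed.

Lemma rank_in_inj : {in P &, injective rank_in}.
Proof.
move=> x y xP yP rxy; apply/eqP/contraT => /(lt_total xP yP).
by rewrite -!ltn_rank_in // rxy ltnn.
Qed.

End Rank.

(** * Words whose fibers are sorted by their minima *)

(** For nonempty sets this is min A < min B, phrased so that empty sets need no default minimum. *)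
Definition starts_before n (A B : {set 'I_n}) : bool :=
  [exists u in A, forall w in B, u < w].

Lemma starts_beforeP n (A B : {set 'I_n}) :
  reflect (exists2 u, u \in A & {in B, forall w : 'I_n, u < w})
          (starts_before A B).
Proof.
apply: (iffP exists_inP) => [[u uA /forall_inP uB]|[u uA uB]]; exists u => //.
exact/forall_inP.
Qed.

Lemma starts_before_irr n : irreflexive (@starts_before n).
Proof.
by move=> A; apply/negbTE/starts_beforeP => -[u uA /(_ u uA)]; rewrite ltnn.
Qed.

Lemma starts_before_trans n : transitive (@starts_before n).
Proof.
move=> B A C /starts_beforeP[u uA uB] /starts_beforeP[w wB wC].
apply/starts_beforeP; exists u => // x xC.
exact: ltn_trans (uB w wB) (wC x xC).
Qed.

Lemma starts_before_total n (A B : {set 'I_n}) :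
  A != set0 -> B != set0 -> [disjoint A & B] ->
  starts_before A B || starts_before B A.
Proof.
move=> /set0Pn[a0 a0A] /set0Pn[b0 b0B] dAB.
case: (@arg_minnP _ a0 [in A] (@nat_of_ord n) a0A) => a aA amin.
case: (@arg_minnP _ b0 [in B] (@nat_of_ord n) b0B) => b bB bmin.
apply/orP; case: (ltngtP a b) => ab.
- left; apply/starts_beforeP; exists a => // w wB.
  exact: leq_trans ab (bmin w wB).
- right; apply/starts_beforeP; exists b => // w wA.
  exact: leq_trans ab (amin w wA).
- by have := disjointFr dAB aA; rewrite (val_inj ab) bB.
Qed.

Section Words.

Variables n k : nat.
Implicit Types (f : {ffun 'I_n -> 'I_k}) (P : {set {set 'I_n}}).

Definition fiber f (i : 'I_k) : {set 'I_n} := [set v | f v == i].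

(** These are the restricted growth functions onto ['I_k]. *)
Definition growth_words : {set {ffun 'I_n -> 'I_k}} :=
  [set f | [forall i, fiber f i != set0] &
           [forall i : 'I_k, forall j : 'I_k,
              (i < j) ==> starts_before (fiber f i) (fiber f j)]].

Lemma growth_wordsP f :
  reflect ((forall i, fiber f i != set0) /\
           (forall i j : 'I_k, i < j -> starts_before (fiber f i) (fiber f j)))
          (f \in growth_words).
Proof.
rewrite inE; apply: (iffP andP) => [[/forallP ne /forallP lt]|[ne lt]].
  by split=> // i j ij; have /forallP/(_ j)/implyP := lt i; apply.
split; first exact/forallP.
by apply/forallP => i; apply/forallP => j; apply/implyP; apply: lt.
Qed.

Lemma starts_before_fiber f (i j : 'I_k) : f \in growth_words ->
  starts_before (fiber f i) (fiber f j) = (i < j).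
Proof.
case/growth_wordsP => _ lt; apply/idP/idP => [sij|]; last exact: lt.
case: (ltngtP i j) => // [ji|/val_inj ij].
  by have := starts_before_trans sij (lt _ _ ji); rewrite starts_before_irr.
by rewrite ij starts_before_irr in sij.
Qed.

(** * Words as set partitions *)

Definition fibers f : {set {set 'I_n}} := [set fiber f i | i : 'I_k].

Lemma fiber_inj f : (forall i, fiber f i != set0) -> injective (fiber f).
Proof.
move=> ne i j eqij; have /set0Pn[v vi] := ne i.
have vj : v \in fiber f j by rewrite -eqij.
by move: vi vj; rewrite !inE => /eqP <- /eqP.
Qed.

Lemma fibers_partition f : (forall i, fiber f i != set0) ->
  partition (fibers f) [set: 'I_n].
Proof.
move=> ne; apply/and3P; split.
- rewrite eqEsubset subsetT /=; apply/subsetP => v _.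
  apply/bigcupP; exists (fiber f (f v)); last by rewrite inE.
  exact: imset_f.
- apply/trivIsetP => _ _ /imsetP[i _ ->] /imsetP[j _ ->] neij.
  rewrite -setI_eq0; apply/eqP/setP => v; rewrite !inE.
  by apply/negbTE/andP => -[/eqP fi /eqP fj]; rewrite -fi -fj eqxx in neij.
- by apply/imsetP => -[i _ /esym/eqP]; apply/negP.
Qed.

Lemma card_fibers f : (forall i, fiber f i != set0) -> #|fibers f| = k.
Proof. by move=> ne; rewrite card_imset ?card_ord //; apply: fiber_inj. Qed.

(** The fibers before [fiber f i] are those of the letters below [i], and they are distinct. Hence a
    letter can be read off the unordered set of fibers. *)
Lemma rank_in_fibers f (i : 'I_k) : f \in growth_words ->
  rank_in (fibers f) (@starts_before n) (fiber f i) = i.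
Proof.
move=> fG; have /growth_wordsP[ne _] := fG.
have widP (j : 'I_i) : j < k by apply: ltn_trans (ltn_ord i).
have widI : injective (fun j : 'I_i => fiber f (Ordinal (widP j))).
  by move=> j1 j2 /(fiber_inj ne)/(congr1 val)/= /val_inj.
rewrite -[RHS]card_ord -(card_imset _ widI); apply: eq_card => B.
rewrite inE; apply/andP/imsetP => [[/imsetP[j _ ->]]|[j _ ->]].
  by rewrite starts_before_fiber // => ji; exists (Ordinal ji).
by split; [apply: imset_f | rewrite starts_before_fiber /=].
Qed.

Lemma fibers_inj : {in growth_words &, injective fibers}.
Proof.
move=> f g fG gG eqfg; apply/ffunP => v; apply: val_inj => /=.
have /growth_wordsP[nef _] := fG; have /growth_wordsP[neg _] := gG.
have /and3P[_ tI _] := fibers_partition nef.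
rewrite -(rank_in_fibers (f v) fG) -(rank_in_fibers (g v) gG) -eqfg.
congr rank_in.
(* Both fibers are the block of [v] in the common partition. *)
rewrite -(@def_pblock _ (fibers f) (fiber f (f v)) v) ?imset_f ?inE //.
by apply: def_pblock; rewrite ?inE // eqfg imset_f.
Qed.

(** The word sends each [v] to the rank of its block when the blocks are sorted by their minima. *)
Lemma partition_fibers P : partition P [set: 'I_n] -> #|P| = k ->
  exists2 f, f \in growth_words & P = fibers f.
Proof.
move=> partP cardP; have /and3P[/eqP covP tI P0] := partP.
pose lt := @starts_before n.
have neP B : B \in P -> B != set0 by move=> BP; apply: contraNneq P0 => <-.
have ltT : {in P &, forall A B, A != B -> lt A B || lt B A}.
  move=> A B AP BP neAB; apply: starts_before_total; rewrite ?neP //.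
  by have /trivIsetP := tI; apply.
have irr : irreflexive lt by apply: starts_before_irr.
have tr : transitive lt by apply: starts_before_trans.
have rlt B : B \in P -> rank_in P lt B < k.
  by rewrite -cardP; apply: rank_in_lt.
have rinj := rank_in_inj irr tr ltT.
have ltr := ltn_rank_in irr tr ltT.
have bP v : pblock P v \in P by rewrite pblock_mem // covP inE.
have fP v : rank_in P lt (pblock P v) < k by rewrite rlt.
pose f : {ffun 'I_n -> 'I_k} := [ffun v => Ordinal (fP v)].
have fE v : f v = rank_in P lt (pblock P v) :> nat by rewrite ffunE.
have fibE B : B \in P -> forall i : 'I_k, rank_in P lt B = i -> fiber f i = B.
  move=> BP i rBi; apply/setP => v; rewrite inE -val_eqE /= fE -rBi.
  rewrite (inj_in_eq rinj) ?bP //; apply/eqP/idP => [<-|vB].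
    by rewrite mem_pblock covP inE.
  exact: def_pblock.
(* Ranks are injective on [k] blocks and take values below [k], so every letter occurs. The default
   of [insubd] is never reached on [P]. *)
have rsur (i : 'I_k) : exists2 B, B \in P & rank_in P lt B = i.
  pose r B : 'I_k := insubd i (rank_in P lt B).
  have rE B : B \in P -> r B = rank_in P lt B :> nat.
    by move=> BP; rewrite val_insubd rlt.
  have : r @: P = setT.
    apply/eqP; rewrite eqEcard subsetT cardsT card_ord.
    rewrite card_in_imset ?cardP ?leqnn //.
    by move=> A B AP BP /(congr1 val) /=; rewrite !rE //; apply: rinj.
  move/setP/(_ i); rewrite inE => /imsetP[B BP ->].
  by exists B => //; rewrite rE.
exists f.
  apply/growth_wordsP; split=> [i|i j].
    by have [B BP rB] := rsur i; rewrite (fibE B BP i rB) neP.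
  have [A AP rA] := rsur i; have [B BP rB] := rsur j.
  by rewrite (fibE A AP i rA) (fibE B BP j rB) -rA -rB ltr.
apply/setP => B; apply/idP/imsetP => [BP|[i _ ->]].
  have rBk : rank_in P lt B < k by rewrite rlt.
  by exists (Ordinal rBk) => //; rewrite (fibE B BP).
by have [A AP rA] := rsur i; rewrite (fibE A AP i rA).
Qed.

Lemma card_growth_words : #|growth_words| = stirling2 n k.
Proof.
rewrite -(card_in_imset fibers_inj); apply: eq_card => P; rewrite inE.
apply/imsetP/andP => [[f /growth_wordsP[ne _] ->]|[partP /eqP cardP]].
  by rewrite fibers_partition // card_fibers.
by have [f fG ->] := partition_fibers partP cardP; exists f.
Qed.

(** The column of [v], counted from 0, in the tableau with row word [f]. *)
Definition occ_rank f (v : 'I_n) : nat :=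
  #|[set u : 'I_n | (u < v) && (f u == f v)]|.

Lemma occ_rank_mono f (u v : 'I_n) :
  f u = f v -> u < v -> occ_rank f u < occ_rank f v.
Proof.
move=> fuv uv; apply: proper_card; apply/properP; split.
  apply/subsetP => w; rewrite !inE fuv => /andP[wu ->].
  by rewrite (ltn_trans wu uv).
by exists u; rewrite !inE ?ltnn // uv fuv eqxx.
Qed.

Lemma occ_rank_inj f (u v : 'I_n) :
  f u = f v -> occ_rank f u = occ_rank f v -> u = v.
Proof.
move=> fuv ruv; case: (ltngtP u v) => [uv|vu|/val_inj //].
  by have := occ_rank_mono fuv uv; rewrite ruv ltnn.
by have := occ_rank_mono (esym fuv) vu; rewrite ruv ltnn.
Qed.

Lemma occ_rank_lt f (v : 'I_n) : occ_rank f v < #|fiber f (f v)|.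
Proof.
apply: proper_card; apply/properP; split.
  by apply/subsetP => w; rewrite !inE => /andP[].
by exists v; rewrite !inE ?ltnn.
Qed.

End Words.

(** * Tableaux and their row words *)

Lemma card_cell (alpha : seq nat) : #|cell alpha| = sumn alpha.
Proof.
rewrite card_tagged sumnE big_map big_enum /=.
under eq_bigr do rewrite card_ord.
by rewrite sumnE (big_nth 0) big_mkord.
Qed.

Lemma card_row_prefix (alpha : seq nat) (c : cell alpha) :
  #|[set d : cell alpha | (tag d == tag c) && (cell_col d < cell_col c)]|
  = cell_col c.
Proof.
case: c => i j; rewrite /cell_col /=.
have widP (x : 'I_j) : x < nth 0 alpha i by apply: ltn_trans (ltn_ord j).
pose g (x : 'I_j) : cell alpha :=
  Tagged (fun i : 'I_(size alpha) => 'I_(nth 0 alpha i)) (Ordinal (widP x)).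
have gI : injective g.
  by move=> x y /(congr1 (@cell_col alpha)) exy; apply: val_inj.
rewrite -[RHS]card_ord -(card_imset _ gI); apply: eq_card => -[i' j'].
rewrite inE /=; apply/andP/imsetP => [[/eqP ei]|[x _ exy]].
  subst i' => j'j; exists (Ordinal j'j) => //.
  by rewrite /g /Tagged; congr existT; apply: val_inj.
have ei : i' = i by apply: (congr1 tag exy).
have ej : j' = x :> nat by apply: (congr1 (@cell_col alpha) exy).
by split; [apply/eqP | rewrite ej].
Qed.

Section RowWords.

Variable alpha : seq nat.
Let n := sumn alpha.
Let k := size alpha.
Implicit Types (T : filling alpha) (f : {ffun 'I_n -> 'I_k}).

(** There are as many cells as labels, so using each label once amounts to bijectivity of [T]. *)
Lemma standard_immaculateP T :
  reflect [/\ bijective T,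
              (forall c d : cell alpha, cell_col c = 0 -> cell_col d = 0 ->
                 cell_row c < cell_row d -> T c < T d)
            & (forall c d : cell alpha, tag c = tag d ->
                 cell_col c < cell_col d -> T c < T d)]
          (standard_immaculate T).
Proof.
apply: (iffP and3P) => [[/forallP T1 /forallP T2 /forallP T3]|[bT T2 T3]].
  split=> [|c d c0 d0 cd|c d cd ccd].
  - apply: inj_card_bij; last by rewrite card_ord card_cell.
    move=> c d Tcd; have /eqP/eq_leq/card_le1_eqP := T1 (T c).
    by apply; rewrite inE // Tcd.
  - by have /forallP/(_ d)/implyP := T2 c; apply; rewrite c0 d0.
  - have /forallP/(_ d)/implyP := T3 c; apply.
    by rewrite /cell_row cd eqxx.
split.
- apply/forallP => v; have [g Tg gT] := bT.
  rewrite -(cards1 (g v)); apply/eqP/eq_card => c; rewrite !inE.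
  by apply/eqP/eqP => [<-|->].
- apply/forallP => c; apply/forallP => d; apply/implyP.
  by case/and3P => /eqP c0 /eqP d0; apply: T2.
- apply/forallP => c; apply/forallP => d; apply/implyP.
  by case/andP => /eqP/val_inj; apply: T3.
Qed.

(** Kept as a relation, since computing [f] from [T] would require the inverse of [T]. *)
Definition row_word T f : bool := [forall c, f (T c) == tag c].

(** Since rows increase, [T] carries the cells to the left of [c] in its row onto the smaller labels
    with the same letter. *)
Lemma row_word_col T f c :
  standard_immaculate T -> row_word T f -> occ_rank f (T c) = cell_col c.
Proof.
case/standard_immaculateP => bT _ T3 /forallP Tf.
rewrite -[RHS]card_row_prefix -(card_imset _ (bij_inj bT)).
have [g Tg gT] := bT; apply: eq_card => v; rewrite inE (eqP (Tf c)).
apply/andP/imsetP => [[vc fv]|[d]].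
  exists (g v); last by rewrite gT.
  have gc : tag (g v) = tag c by rewrite -(eqP (Tf _)) gT; apply/eqP.
  (* Were [g v] at or to the right of [c], row monotonicity would give [T c <= v]. *)
  rewrite inE gc eqxx /= ltnNge; apply/negP => cg.
  have := vc; rewrite ltnNge -{1}(gT v) => /negP; apply; move: cg.
  rewrite leq_eqVlt => /orP[/eqP cg|/T3/ltnW]; last by rewrite gT; apply.
  suff -> : c = g v by rewrite gT.
  clear -gc cg; move: c (g v) gc cg => [i j] [i' j'] /= ei.
  by subst i' => /val_inj /= ->.
rewrite inE => /andP[/eqP dc col_dc] ->.
by rewrite T3 // (eqP (Tf d)) dc eqxx.
Qed.

Lemma row_word_exists T : all (fun a => 0 < a) alpha ->
  standard_immaculate T ->
  exists2 f, (f \in growth_words n k) &&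
             [forall i, #|fiber f i| == nth 0 alpha i]
           & row_word T f.
Proof.
move=> pos sT; have /standard_immaculateP[bT T2 T3] := sT.
have [g Tg gT] := bT.
pose f : {ffun 'I_n -> 'I_k} := [ffun v => tag (g v)].
have Tf : row_word T f by apply/forallP => c; rewrite ffunE Tg.
have cf i : #|fiber f i| = nth 0 alpha i.
  pose h (j : 'I_(nth 0 alpha i)) : cell alpha :=
    Tagged (fun i : 'I_(size alpha) => 'I_(nth 0 alpha i)) j.
  have hI : injective (T \o h).
    move=> x y /(bij_inj bT) /(congr1 (@cell_col alpha)) exy.
    exact: val_inj.
  rewrite -[RHS]card_ord -(card_imset _ hI); apply: eq_card => v.
  rewrite inE ffunE; apply/eqP/imsetP => [gi|[j _ ->]]; last by rewrite /= Tg.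
  have [j gj] : exists j, g v = h j.
    by case: (g v) gi => i' j /= ei; subst i'; exists j.
  by exists j => //=; rewrite -gj gT.
exists f => //; apply/andP; split; last by apply/forallP => i; rewrite cf.
(* Positive parts give every row a cell in column 0; its entry witnesses [starts_before]. *)
have posi (i : 'I_k) : 0 < nth 0 alpha i by rewrite (all_nthP 0 pos).
apply/growth_wordsP; split=> [i|i j ij]; first by rewrite -card_gt0 cf.
pose first (i : 'I_k) : cell alpha :=
  Tagged (fun i : 'I_(size alpha) => 'I_(nth 0 alpha i)) (Ordinal (posi i)).
apply/starts_beforeP; exists (T (first i)); first by rewrite inE ffunE Tg.
move=> w; rewrite inE ffunE => /eqP gw.
have lt_ij : T (first i) < T (first j) by apply: T2.
(* It remains to see that [first j] holds the minimum of its row: a smaller entry [w] there would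
   sit in column 0, hence in [first j] itself. *)
apply: leq_trans lt_ij _; rewrite leqNgt -(gT w); apply/negP => wj.
have jw : tag (first j) = tag (g w) by rewrite gw.
have col_w : cell_col (g w) <= cell_col (first j).
  rewrite leqNgt; apply/negP => /(T3 _ _ jw) /(ltn_trans wj).
  by rewrite ltnn.
suff eqw : g w = first j by rewrite eqw ltnn in wj.
case: (g w) gw col_w => j' x /= ej; subst j'.
rewrite leqn0 => /eqP x0.
by rewrite /first /Tagged; congr existT; apply: val_inj.
Qed.

(** Placing [v] in row [f v] and column [occ_rank f v] is injective, hence bijective by cardinality;
    the tableau is the inverse map. *)
Lemma row_word_of f : f \in growth_words n k ->
  (forall i, #|fiber f i| = nth 0 alpha i) ->
  exists2 T, standard_immaculate T & row_word T f.
Proof.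
move=> /growth_wordsP[_ fG] cf.
(* The content condition makes the column fit into the row. *)
have colP v : occ_rank f v < nth 0 alpha (f v) by rewrite -cf occ_rank_lt.
pose S v : cell alpha :=
  Tagged (fun i : 'I_(size alpha) => 'I_(nth 0 alpha i)) (Ordinal (colP v)).
have SI : injective S.
  move=> u v Suv; apply: (@occ_rank_inj _ _ f).
    exact: (congr1 tag Suv).
  exact: (congr1 (@cell_col alpha) Suv).
have bS : bijective S by apply: inj_card_bij; rewrite // card_ord card_cell.
have [g Sg gS] := bS.
pose T : filling alpha := [ffun c => g c].
have TE c : T c = g c by rewrite ffunE.
have fT c : f (T c) = tag c by rewrite TE -{2}(gS c).
have rT c : occ_rank f (T c) = cell_col c by rewrite TE -{2}(gS c).
exists T; last by apply/forallP => c; rewrite fT.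
apply/standard_immaculateP; split.
- by exists S => x; rewrite TE.
- move=> c d c0 _ /fG /starts_beforeP[u]; rewrite inE => /eqP fu ltu.
  have ud : u < T d by apply: ltu; rewrite inE fT.
  (* No label of the row of [c] lies below [T c], because [T c] has [occ_rank] 0. *)
  apply: leq_ltn_trans ud; rewrite leqNgt; apply/negP => uc.
  have := @occ_rank_mono _ _ f u (T c); rewrite rT c0 fT fu.
  by move/(_ erefl uc).
- move=> c d cd ccd; rewrite ltnNge leq_eqVlt; apply/norP; split.
    apply/eqP => /val_inj edc.
    by have := ccd; rewrite -!rT edc ltnn.
  apply/negP => dc; have := @occ_rank_mono _ _ f (T d) (T c).
  by rewrite !fT !rT => /(_ (esym cd) dc)/(ltn_trans ccd); rewrite ltnn.
Qed.

(** A word fixes the row and column of each label, hence the tableau; a tableau fixes the word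
    because [T] is onto. Each direction yields one inequality. *)
Lemma num_immaculate_words : all (fun a => 0 < a) alpha ->
  num_immaculate alpha =
  #|[set f in growth_words n k | [forall i, #|fiber f i| == nth 0 alpha i]]|.
Proof.
move=> pos; apply/eqP; rewrite eqn_leq; apply/andP; split.
  apply: (leq_card_rel (R := row_word)) => [T|T1 T2].
    rewrite inE => /(row_word_exists pos)[f fG Tf].
    by exists f => //; rewrite inE.
  rewrite !inE => s1 s2 f _ w1 w2; apply/ffunP => c.
  apply: (@occ_rank_inj _ _ f); last by rewrite !row_word_col.
  by rewrite (eqP (forallP w1 c)) (eqP (forallP w2 c)).
apply: (leq_card_rel (R := fun f T => row_word T f)) => [f|f1 f2].
  rewrite inE => /andP[fG /forallP cf].
  have [i|T sT Tf] := row_word_of fG; first exact/eqP.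
  by exists T; rewrite ?inE.
move=> _ _ T; rewrite inE => /standard_immaculateP[[g _ gT] _ _] w1 w2.
apply/ffunP => v.
by rewrite -(gT v) (eqP (forallP w1 _)) (eqP (forallP w2 _)).
Qed.

End RowWords.

(** * Summation over all shapes *)

(** Frees the type of words from [alpha], so that all shapes share one set of words without
    casts. *)
Lemma num_immaculate_growth_words (alpha : seq nat) (n k : nat) :
  all (fun a => 0 < a) alpha -> sumn alpha = n -> size alpha = k ->
  num_immaculate alpha =
  #|[set f in growth_words n k | [forall i, #|fiber f i| == nth 0 alpha i]]|.
Proof. by move=> pos <- <-; apply: num_immaculate_words. Qed.

(** A fiber has at most [n] elements, so [inord] never falls back to its default. *)
Definition content n k (f : {ffun 'I_n -> 'I_k}) : k.-tuple 'I_n.+1 :=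
  [tuple inord #|fiber f i| | i < k].

Lemma tnth_content n k (f : {ffun 'I_n -> 'I_k}) i :
  tnth (content f) i = #|fiber f i| :> nat.
Proof.
by rewrite tnth_mktuple inordK // ltnS -[X in _ <= X]card_ord max_card.
Qed.

Lemma nth_map_val n k (a : k.-tuple 'I_n.+1) (i : 'I_k) :
  nth 0 (map (@nat_of_ord n.+1) a) i = tnth a i.
Proof. by rewrite (nth_map ord0) ?size_tuple // -tnth_nth. Qed.

Lemma content_composition n k (f : {ffun 'I_n -> 'I_k}) :
  f \in growth_words n k -> content f \in compositions n k.
Proof.
case/growth_wordsP => ne _; rewrite inE; apply/andP; split.
  apply/(all_nthP 0) => i; rewrite size_map size_tuple => ik.
  by rewrite (nth_map_val _ (Ordinal ik)) tnth_content card_gt0.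
rewrite sumnE big_map big_tuple; apply/eqP.
under eq_bigr do rewrite tnth_content -sum1_card.
rewrite -[RHS]card_ord -sum1_card (partition_big f xpredT) //=.
by apply: eq_bigr => i _; apply: eq_bigl => v; rewrite inE.
Qed.

Theorem theorem3p1 (n k : nat) (hk : 1 <= k) (hkn : k <= n) :
  \sum_(alpha in compositions n k) num_immaculate (map (@nat_of_ord n.+1) alpha)
  = stirling2 n k.
Proof.
rewrite -card_growth_words -sum1_card.
(* Words are grouped by content; each group is then matched with the tableaux of that shape. *)
rewrite (partition_big (@content n k) (mem (compositions n k))) /=; last first.
  exact: content_composition.
apply: eq_bigr => a; rewrite inE => /andP[pos /eqP suma].
rewrite (num_immaculate_growth_words (k := k) pos suma); last first.
  by rewrite size_map size_tuple.
rewrite -sum1_card; apply: eq_bigl => f; rewrite inE; congr (_ && _).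
apply/forallP/eqP => [cf|<- i]; last by rewrite nth_map_val tnth_content.
apply: eq_from_tnth => i; apply: val_inj.
by rewrite /= tnth_content (eqP (cf i)) nth_map_val.
Qed.
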